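(* Let $-1<m<n$ and $0\le\alpha\le 1$ be in one of the parameter ranges listed below. There is a constant $C>0$ (depending on $m,n,\alpha$ but not on $N$) such that, for every $N\ge 2$, the following estimates hold for any critical point $X_N$ of the energy $E$: $$l_*\geq\lambda_N\geq\begin{cases}CN^{-\frac{(1-m)\alpha}{n-m}}, & -1<m<1<n,\ m\neq0,\ 0<\alpha\leq1,\\ CN^{-\frac{\alpha}{n}}(\log N)^{-\frac1n}, & m=0,\ 1<n,\ 0<\alpha\leq1,\\ C, & 1<m<n,\ 0<\alpha\leq1,\\ C, & -1<m<n,\ \alpha=0;\end{cases}$$ $$(N-1)l_*\geq w_N\geq\begin{cases}CN^{1-\frac{(1-m)\alpha}{n-m}}, & -1<m<1<n,\ m\neq0,\ 0<\alpha\leq1,\\ CN^{1-\frac{\alpha}{n}}(\log N)^{-\frac1n}, & m=0,\ 1<n,\ 0<\alpha\leq1,\\ CN, & 1<m<n,\ 0<\alpha\leq1,\\ CN, & -1<m<n,\ \alpha=0.\end{cases}$$ In particular, if ($1<m<n$, $0<\alpha\leq1$) or ($-1<m<n$, $1<n$, $\alpha=0$), then any sequence of critical points $\{X_N\}_{N=1}^\infty$ is a non-bunching sequence.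
   Context: For real $-1<m<n$ (not necessarily integers) the pair potential is, for $x\neq 0$, $V(x)=-\frac1m|x|^{-m}+\frac1n|x|^{-n}$ if $m\neq0,n\neq 0$; $V(x)=\log|x|+\frac1n|x|^{-n}$ if $m=0<n$; $V(x)=-\frac1m|x|^{-m}-\log|x|$ if $m<n=0$. The unique critical point of $V$ on $(0,\infty)$ is $l_*=1$. For $0\le\alpha\le1$ and a step configuration $X_N=(x_1,\dots,x_N)$ with $x_1<\cdots<x_N$, the energy is $E[X_N]=\sum_{1\le i<j\le N,\ j-i\le\lfloor N^\alpha\rfloor}V(x_j-x_i)$. A critical point of $E$ is a configuration $x_1<\cdots<x_N$ with $\partial E/\partial x_i=0$ for all $i=1,\dots,N$. For a configuration $X_N$: the minimal terrace length is $\lambda_N:=\min_{1\le i\le N-1}(x_{i+1}-x_i)$ and the system size is $w_N:=x_N-x_1$. A sequence of configurations $\{X_N\}$ is a non-bunching sequence if $\liminf_{N\to\infty}w_N/N>0$. *)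

(* Defs.v *)
From HB Require Import structures.
From mathcomp Require Import all_boot all_order all_algebra.
From mathcomp Require Import all_classical all_reals all_analysis.

Set Implicit Arguments.
Unset Strict Implicit.
Unset Printing Implicit Defensive.

Import Order.TTheory GRing.Theory Num.Theory.
Import numFieldNormedType.Exports.

Local Open Scope ring_scope.
Local Open Scope classical_set_scope.

Section Terraces.
Context {R : realType}.
Implicit Types m n alpha : R.

(* Relevant only for x != 0; the value at 0 is never used. *)
Definition pair_potential m n (x : R) : R :=
  if m == 0 then ln `|x| + n^-1 * `|x| `^ (- n)
  else if n == 0 then - m^-1 * `|x| `^ (- m) - ln `|x|
  else - m^-1 * `|x| `^ (- m) + n^-1 * `|x| `^ (- n).

(* The critical point of [pair_potential m n] on ]0, +oo[; see [lstarP]. *)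
Definition lstar : R := 1.

Lemma is_derive_pair_potential m n (x : R) : 0 < x -> m < n ->
  is_derive x 1 (pair_potential m n) (x `^ (- m - 1) - x `^ (- n - 1)).
Proof.
move=> x0 mn.
have dP p : p != 0 ->
    is_derive x 1 (fun y : R => - p^-1 * `|y| `^ (- p)) (x `^ (- p - 1)).
  move=> p0; apply: (@near_eq_is_derive _ _ _ (- p^-1 \*: (@powR R)^~ (- p))).
    near=> y; have y0 : 0 < y by near: y; exact: lt_nbhsr.
    by rewrite gtr0_norm.
  apply: is_derive_eq; first by apply: is_deriveZ; exact: is_derive1_powR.
  by rewrite /GRing.scale/= mulrA mulrNN mulVf// mul1r.
have dL : is_derive x 1 (fun y : R => ln `|y|) (x `^ (- 0 - 1)).
  apply: (@near_eq_is_derive _ _ _ (@ln R)).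
    near=> y; have y0 : 0 < y by near: y; exact: lt_nbhsr.
    by rewrite gtr0_norm.
  by rewrite oppr0 add0r powR_inv1 ?ltW//; exact: is_derive1_ln.
rewrite /pair_potential; have [m0|m0] := eqVneq m 0.
  have n0 : n != 0 by rewrite gt_eqF// -m0.
  rewrite (_ : (fun _ => _) = (fun y : R => ln `|y|) -
      (fun y : R => - n^-1 * `|y| `^ (- n))); last first.
    by apply/funext => y; rewrite !fctE /= mulNr opprK.
  by rewrite m0; apply: is_deriveB => //; exact: dP.
have [n0|n0] := eqVneq n 0.
  by rewrite n0; apply: is_deriveB => //; exact: dP.
rewrite (_ : (fun _ => _) = (fun y : R => - m^-1 * `|y| `^ (- m)) -
    (fun y : R => - n^-1 * `|y| `^ (- n))); last first.
  by apply/funext => y; rewrite !fctE /= [- n^-1 * _]mulNr opprK.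
by apply: is_deriveB => //; exact: dP.
Unshelve. all: by end_near. Qed.

Lemma lstarP m n (x : R) : m < n -> 0 < x ->
  is_derive x 1 (pair_potential m n) 0 <-> x = lstar.
Proof.
move=> mn x0; have dV := is_derive_pair_potential x0 mn; split=> [d0|x1].
  move: (@derive_val _ _ _ _ _ _ _ dV); rewrite (@derive_val _ _ _ _ _ _ _ d0).
  move/esym/eqP; rewrite subr_eq0 /powR (gt_eqF x0) => /eqP/expR_inj/eqP.
  rewrite -subr_eq0 -mulrBl mulf_eq0 => /orP[|]; last first.
    by rewrite ln_eq0// => /eqP.
  by rewrite opprB addrA subrK opprK addrC subr_eq0 gt_eqF.
by move: dV; rewrite x1 /lstar !powR1 subrr.
Qed.

Definition interaction_range alpha (N : nat) : nat :=
  Num.truncn (N%:R `^ alpha : R).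

(* A row vector X : 'rV[R]_N holds the steps x_1, ..., x_N at the indices
   0, ..., N - 1; [site X k] is its entry of index k, and 0 if k >= N. *)
Definition site N (X : 'rV[R]_N) (k : nat) : R := oapp (X 0) 0 (insub k).

Definition step_configuration N (X : 'rV[R]_N) : Prop :=
  forall i j : 'I_N, (i < j)%N -> X 0 i < X 0 j.

Definition energy m n alpha N (X : 'rV[R]_N) : R :=
  \sum_(i < N)
    \sum_(j < N | (i < j)%N && (j - i <= interaction_range alpha N)%N)
      pair_potential m n (X 0 j - X 0 i).

Definition critical_point m n alpha N (X : 'rV[R]_N) : Prop :=
  step_configuration X /\
  forall i : 'I_N, is_derive X (delta_mx 0 i) (@energy m n alpha N) 0.

Definition terrace N (X : 'rV[R]_N) (k : nat) : R := site X k.+1 - site X k.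

(* For N >= 2 the first terrace is one of those ranged over, so using it as
   initial value does not affect the minimum. *)
Definition min_terrace N (X : 'rV[R]_N) : R :=
  \big[Order.min/terrace X 0]_(k < N.-1) terrace X k.

Definition system_size N (X : 'rV[R]_N) : R := site X N.-1 - site X 0.

(* The liminf ignores the term N = 0. *)
Definition non_bunching (X : forall N, 'rV[R]_N) : Prop :=
  (0 < limn_einf (fun N => (system_size (X N) / N%:R)%:E))%E.

Definition sublinear_range m n alpha : bool :=
  [&& -1 < m < 1, 1 < n, m != 0 & 0 < alpha <= 1].

Definition logarithmic_range m n alpha : bool :=
  [&& m == 0, 1 < n & 0 < alpha <= 1].

Definition short_range m n alpha : bool := (1 < m < n) && (0 < alpha <= 1).

Definition nearest_neighbour_range m n alpha : bool :=
  (-1 < m < n) && (alpha == 0).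

Definition admissible_range m n alpha : bool :=
  [|| sublinear_range m n alpha, logarithmic_range m n alpha,
      short_range m n alpha | nearest_neighbour_range m n alpha].

(* The final branch covers [short_range] and [nearest_neighbour_range]. *)
Definition terrace_rate m n alpha (N : nat) : R :=
  if sublinear_range m n alpha then
    N%:R `^ (- ((1 - m) * alpha / (n - m)))
  else if logarithmic_range m n alpha then
    N%:R `^ (- (alpha / n)) * ln N%:R `^ (- n^-1)
  else 1.

Definition size_rate m n alpha (N : nat) : R :=
  if sublinear_range m n alpha then
    N%:R `^ (1 - (1 - m) * alpha / (n - m))
  else if logarithmic_range m n alpha then
    N%:R `^ (1 - alpha / n) * ln N%:R `^ (- n^-1)
  else N%:R.

End Terraces.
Arguments lstar R : clear implicits.

(* Main.v *)
Require Import Defs.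
From HB Require Import structures.
From mathcomp Require Import all_boot all_order all_algebra.
From mathcomp Require Import all_classical all_reals all_analysis.
From mathcomp Require Import lra ring.
Import Order.TTheory GRing.Theory Num.Theory.
Import numFieldNormedType.Exports.
Local Open Scope ring_scope.

(** Adding the equations dE/dx_i = 0 over all steps i <= k cancels every
interaction between two steps on the same side of the gap (k, k+1), and leaves
the balance law [cut_balance]: the forces V'(x_j - x_i) of the pairs i <= k < j
within the interaction range K sum to zero.  Since V'(d) = d^(-m-1) - d^(-n-1)
is positive exactly for d > 1, this law carries both estimates.

If the terrace (k, k+1) were longer than 1, so would be every distance across
the gap, and the total force would be positive.  Hence all terraces are at most
1 ([terrace_le1]), which gives the two upper bounds.

For the lower bounds, cut at the minimal terrace, of length l.  The balance law
says that the sum of the d^(-n-1) equals the sum of the d^(-m-1).  The first sum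
contains the term l^(-n-1).  In the second one, a pair with j - i = p is at
distance at least p l, and at most p pairs with this index difference straddle
the gap ([sum_cut_le]), so that it is at most the sum over p <= K of
p (p l)^(-m-1).  Dividing by l^(-m-1) yields [min_terrace_powR_le]:
  l^(-(n-m)) <= 1^(-m) + ... + K^(-m).
With K <= N^alpha, the right-hand side is at most of order N^(alpha (1-m)) when
m < 1, is bounded when m > 1, and is 1 when alpha = 0; raising to the power -1/(n-m)
gives the rates.  For m = 0 this argument even gives N^(-alpha/n) without the
logarithm, which is harmless since log N >= log 2.  The bound on the system size
is N - 1 times the bound on the minimal terrace, and it is linear in N when the
rate of the latter is constant, whence the absence of bunching. *)

(** * The force balance across a gap *)

Lemma is_derive_scale_direction {R : realType} (f : R -> R) (x c df : R) :
  is_derive x 1 f df -> is_derive x c f (c * df).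
Proof.
move=> dfx; have /derivable1_diffP fx := @ex_derive _ _ _ _ _ _ _ dfx.
apply: DeriveDef; first exact: diff_derivable.
by rewrite deriveE// -[c in 'd f x c](mulr1 c) linearZ/= -deriveE// derive_val.
Qed.

(** Moving X along v moves the gap X_j - X_i at the constant rate v_j - v_i, so
both derivatives are limits of the same difference quotient. *)
Lemma is_derive_gap {R : realType} N (f : R -> R) (df : R) (X v : 'rV[R]_N)
    (i j : 'I_N) :
  is_derive (X 0 j - X 0 i) 1 f df ->
  is_derive X v (fun Y : 'rV[R]_N => f (Y 0 j - Y 0 i))
    ((v 0 j - v 0 i) * df).
Proof.
move=> /(@is_derive_scale_direction _ _ _ (v 0 j - v 0 i)) [f1 f2].
have E : (fun h : R => h^-1 *: (((fun Y : 'rV[R]_N => f (Y 0 j - Y 0 i)) \o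
      shift X) (h *: v) - f (X 0 j - X 0 i))) =
    (fun h : R => h^-1 *: ((f \o shift (X 0 j - X 0 i))
      (h *: (v 0 j - v 0 i)) - f (X 0 j - X 0 i))).
  apply/funext => h /=; congr (_ *: (f _ - _)).
  by rewrite !mxE scalerBr /GRing.scale/=; ring.
by apply: DeriveDef; rewrite ?/derivable ?/derive E.
Qed.

Lemma is_derive_bigsum {R : realType} (V : normedModType R) (I : finType)
    (P : pred I) (f : I -> V -> R) (df : I -> R) (x v : V) :
  (forall i, P i -> is_derive x v (f i) (df i)) ->
  is_derive x v (fun y => \sum_(i | P i) f i y) (\sum_(i | P i) df i).
Proof.
move=> h; rewrite [X in is_derive _ _ X _](_ : _ = \sum_(i | P i) f i); last first.
  by apply/funext => y; rewrite fct_sumE.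
by elim/big_ind2 : _ => // [|] *; [exact: is_derive_cst|exact: is_deriveD].
Qed.

(** The derivative of [pair_potential m n] on the positive half-line. *)
Definition force {R : realType} (m n d : R) := d `^ (- m - 1) - d `^ (- n - 1).

Lemma is_derive_energy {R : realType} {m n alpha : R} {N} (X v : 'rV[R]_N) :
  m < n -> step_configuration X ->
  is_derive X v (@energy R m n alpha N)
    (\sum_(i < N)
      \sum_(j < N | (i < j)%N && (j - i <= interaction_range alpha N)%N)
        (v 0 j - v 0 i) * force m n (X 0 j - X 0 i)).
Proof.
move=> mn Xlt; apply: is_derive_bigsum => i _.
apply: is_derive_bigsum => j /andP[ij _]; apply: is_derive_gap.
by apply: is_derive_pair_potential; rewrite // subr_gt0 Xlt.
Qed.

(** Summing the partial derivatives over the steps l <= k multiplies the force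
of a pair i < j by [j <= k] - [i <= k] (brackets being 0 or 1), which is -1 if
the pair straddles the gap and 0 otherwise. *)
Lemma cut_balance {R : realType} {m n alpha : R} {N} {X : 'rV[R]_N} k :
  m < n -> critical_point m n alpha X ->
  \sum_(i < N) \sum_(j < N | [&& (i <= k)%N, (k < j)%N &
      (j - i <= interaction_range alpha N)%N])
    force m n (X 0 j - X 0 i) = 0.
Proof.
move=> mn [Xlt crit]; set K := interaction_range alpha N.
pose v : 'I_N -> 'rV[R]_N := delta_mx 0.
have part l : \sum_(i < N) \sum_(j < N | (i < j)%N && (j - i <= K)%N)
    (v l 0 j - v l 0 i) * force m n (X 0 j - X 0 i) = 0.
  have [_ <-] := is_derive_energy (alpha := alpha) X (v l) mn Xlt.
  by have [_] := crit l.
apply/eqP; rewrite -oppr_eq0; apply/eqP.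
have cut (i : 'I_N) : \sum_(l < N | (l <= k)%N) v l 0 i = (i <= k)%N%:R :> R.
  under eq_bigr do rewrite mxE eqxx/=.
  rewrite big_mkcond (bigD1 i)//= eqxx big1 ?addr0; first by case: ifP.
  by move=> l li; rewrite eq_sym (negPf li); case: ifP.
transitivity (\sum_(l < N | (l <= k)%N) \sum_(i < N)
    \sum_(j < N | (i < j)%N && (j - i <= K)%N)
    (v l 0 j - v l 0 i) * force m n (X 0 j - X 0 i)); last first.
  by rewrite big1.
rewrite exchange_big -sumrN; apply: eq_bigr => i _.
rewrite exchange_big -sumrN big_mkcond [RHS]big_mkcond; apply: eq_bigr => j _.
rewrite -mulr_suml sumrB !cut.
have [ik|ki] := leqP i k; have [jk|kj] := leqP j k => //=.
- by rewrite subrr mul0r if_same.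
- by rewrite (leq_ltn_trans ik kj) sub0r mulN1r.
- by rewrite ltnNge (leq_trans jk (ltnW ki)).
- by rewrite subrr mul0r if_same.
Qed.

(** For each p, a pair i <= k < j with j - i = p is determined by k - i < p, so
there are at most p of them. *)
Lemma sum_cut_le {R : realType} (g : nat -> R) (N K k : nat) :
  (forall p, 0 <= g p) ->
  \sum_(i < N) \sum_(j < N | [&& (i <= k)%N, (k < j)%N & (j - i <= K)%N])
    g (j - i)%N <= \sum_(p < K) p.+1%:R * g p.+1.
Proof.
move=> g0.
pose cut (u : 'I_N * 'I_N) := [&& (u.1 <= k)%N, (k < u.2)%N & (u.2 - u.1 <= K)%N].
rewrite pair_big_dep (eq_bigl cut)/=; last by [].
have gE u : cut u ->
    g (u.2 - u.1)%N = \sum_(p < K | (u.2 - u.1 == p.+1)%N) g p.+1.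
  case/and3P => uk ku uK.
  have u12 : (0 < u.2 - u.1)%N by rewrite subn_gt0 (leq_ltn_trans uk ku).
  have pK : ((u.2 - u.1).-1 < K)%N by rewrite prednK.
  rewrite (big_pred1 (Ordinal pK)) ?prednK// => p.
  by rewrite /= -val_eqE/= -[RHS]eqSS prednK// eq_sym.
rewrite (eq_bigr _ gE).
rewrite (exchange_big_dep xpredT)//=; apply: ler_sum => p _.
rewrite sumr_const -[leLHS]mulr_natl ler_wpM2r// ler_nat.
set A := (X in #|X|); pose h (u : 'I_N * 'I_N) : 'I_p.+1 := inord (k - u.1).
have hA u : u \in A -> [/\ (u.1 <= k)%N, (k < u.2)%N & (u.2 = u.1 + p.+1 :> nat)%N].
  case/andP => /and3P[uk ku _] /eqP up; split => //.
  by rewrite -up subnKC// (leq_trans uk (ltnW ku)).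
rewrite -[leqRHS]card_ord -(@card_in_image _ _ h A) ?max_card//.
have small (a b : nat) : (k < b)%N -> b = (a + p.+1)%N -> (k - a < p.+1)%N.
  by move=> kb bE; rewrite ltnS leq_subLR -ltnS -addnS -bE.
move=> [i j] [i' j'] /hA[/= ik kj jE] /hA[/= i'k kj' j'E] /(congr1 val).
rewrite /= (inordK (small _ _ kj jE)) (inordK (small _ _ kj' j'E)) => kE.
have ii' : i = i' :> nat by rewrite -(subKn ik) kE subKn.
by congr (_, _); apply: val_inj => //=; rewrite jE j'E ii'.
Qed.

(** * Terraces *)

Lemma siteE {R : realType} {N} (X : 'rV[R]_N) (i : 'I_N) : site X i = X 0 i.
Proof. by rewrite /site valK. Qed.

Lemma sum_terrace {R : realType} {N} (X : 'rV[R]_N) {i j} : (i <= j)%N ->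
  site X j - site X i = \sum_(i <= k < j) terrace X k.
Proof. by move=> ij; rewrite /terrace telescope_sumr. Qed.

Lemma site_le {R : realType} {N} (X : 'rV[R]_N) i j :
  step_configuration X -> (i <= j)%N -> (j < N)%N -> site X i <= site X j.
Proof.
move=> Xlt; rewrite leq_eqVlt => /predU1P[->//|ij] jN.
have := Xlt (Ordinal (ltn_trans ij jN)) (Ordinal jN) ij.
by rewrite -!siteE => /ltW.
Qed.

Lemma terrace_gt0 {R : realType} {N} (X : 'rV[R]_N) k :
  step_configuration X -> (k.+1 < N)%N -> 0 < terrace X k.
Proof.
move=> Xlt kN; rewrite /terrace subr_gt0.
by have := Xlt (Ordinal (ltnW kN)) (Ordinal kN) (ltnSn k); rewrite -!siteE.
Qed.

Lemma min_terrace_le {R : realType} {N} (X : 'rV[R]_N) k :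
  (k.+1 < N)%N -> min_terrace X <= terrace X k.
Proof.
move=> kN; have kN1 : (k < N.-1)%N by rewrite -ltnS prednK// (ltn_trans _ kN).
exact: (bigmin_le _ (Ordinal kN1) (fun k : 'I_N.-1 => terrace X k)).
Qed.

Lemma min_terrace_attained {R : realType} {N} (X : 'rV[R]_N) :
  (2 <= N)%N -> exists2 k, (k.+1 < N)%N & min_terrace X = terrace X k.
Proof.
move=> N2; apply: (big_ind (fun x => exists2 k, (k.+1 < N)%N & x = terrace X k)).
- by exists 0%N.
- by move=> x y xP yP; rewrite minEle; case: ifP.
- by move=> k _; exists k => //; rewrite -ltn_predRL.
Qed.

Lemma min_terrace_gt0 {R : realType} {N} (X : 'rV[R]_N) :
  step_configuration X -> (2 <= N)%N -> 0 < min_terrace X.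
Proof.
by move=> Xlt N2; have [k kN ->] := min_terrace_attained X N2; exact: terrace_gt0.
Qed.

Lemma gap_ge {R : realType} {N} (X : 'rV[R]_N) i j :
  (i <= j)%N -> (j < N)%N -> (j - i)%:R * min_terrace X <= site X j - site X i.
Proof.
move=> ij jN; rewrite sum_terrace// mulr_natl -sumr_const_nat.
by apply: ler_sum_nat => k /andP[_ kj]; apply: min_terrace_le; exact: leq_ltn_trans jN.
Qed.

(** * Consequences of the force balance *)

Lemma interaction_range_gt0 {R : realType} {alpha : R} {N} :
  0 <= alpha -> (0 < N)%N -> (0 < interaction_range alpha N)%N.
Proof.
by move=> a0 N0; rewrite truncn_gt0 -[leLHS](powRr0 N%:R) ler_powR// ler1n.
Qed.

(** A longer terrace would make every distance across it exceed 1, so that all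
pairs straddling it, among which its two ends, would attract each other. *)
Lemma terrace_le1 {R : realType} {m n alpha : R} {N} {X : 'rV[R]_N} {k} :
  m < n -> 0 <= alpha -> critical_point m n alpha X -> (k.+1 < N)%N ->
  terrace X k <= 1.
Proof.
move=> mn a0 crit kN; have [Xlt _] := crit; rewrite leNgt; apply/negP => k1.
have/eqP := cut_balance k mn crit; rewrite gt_eqF//.
have K0 := interaction_range_gt0 a0 (leq_ltn_trans (leq0n _) kN).
have force_gt0 (i j : 'I_N) : (i <= k)%N -> (k < j)%N ->
    0 < force m n (X 0 j - X 0 i).
  move=> ik kj; have d1 : 1 < X 0 j - X 0 i.
    apply: (lt_le_trans k1); rewrite -!siteE lerB// site_le// ?(ltnW kN)//.
  rewrite subr_gt0 /powR gt_eqF ?(lt_trans _ d1)// ltr_expR ltr_pM2r ?ln_gt0//.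
  lra.
have kN' := ltnW kN.
rewrite (bigD1 (Ordinal kN'))//= ltr_pwDl//.
  rewrite (bigD1 (Ordinal kN))/= ?leqnn ?ltnSn ?subSnn//.
  rewrite ltr_pwDl ?force_gt0//= sumr_ge0// => j /andP[/andP[kj _] _].
  exact/ltW/force_gt0.
rewrite sumr_ge0// => i _; rewrite sumr_ge0// => j /and3P[ik kj _].
exact/ltW/force_gt0.
Qed.

(** The balance at the minimal terrace: the repulsion of its two ends is at most
the total attraction across it, in which all distances are bounded from below by
multiples of the minimal terrace. *)
Lemma min_terrace_powR_le {R : realType} {m n alpha : R} {N} {X : 'rV[R]_N} :
  -1 < m -> m < n -> 0 <= alpha -> critical_point m n alpha X -> (2 <= N)%N ->
  min_terrace X `^ (- (n - m)) <=
    \sum_(p < interaction_range alpha N) p.+1%:R `^ (- m).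
Proof.
move=> m1 mn a0 crit N2; have [Xlt _] := crit.
have [k kN kE] := min_terrace_attained X N2.
have l0 := min_terrace_gt0 X Xlt N2.
have K0 := interaction_range_gt0 a0 (ltnW N2).
set K := interaction_range alpha N in K0 *; set l := min_terrace X in kE l0 *.
have /eqP := cut_balance k mn crit; rewrite -/K /force.
under eq_bigr do rewrite sumrB.
rewrite sumrB subr_eq0 => /eqP balance.
have low : l `^ (- n - 1) <= \sum_(i < N) \sum_(j < N |
    [&& (i <= k)%N, (k < j)%N & (j - i <= K)%N]) (X 0 j - X 0 i) `^ (- n - 1).
  have kN' := ltnW kN; rewrite (bigD1 (Ordinal kN'))//=.
  rewrite (bigD1 (Ordinal kN))/= ?leqnn ?ltnSn ?subSnn// kE /terrace.
  rewrite -!siteE -addrA lerDl addr_ge0 ?sumr_ge0// => *; first exact: powR_ge0.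
  by apply: sumr_ge0 => *; exact: powR_ge0.
have high : \sum_(i < N) \sum_(j < N | [&& (i <= k)%N, (k < j)%N &
    (j - i <= K)%N]) (X 0 j - X 0 i) `^ (- m - 1) <=
    l `^ (- m - 1) * \sum_(p < K) p.+1%:R `^ (- m).
  pose g p : R := (p%:R * l) `^ (- m - 1).
  apply: (@le_trans _ _ (\sum_(i < N) \sum_(j < N |
      [&& (i <= k)%N, (k < j)%N & (j - i <= K)%N]) g (j - i)%N)).
    apply: ler_sum => i _; apply: ler_sum => j /and3P[ik kj _].
    have ij := leq_ltn_trans ik kj.
    have d0 : 0 < (j - i)%:R * l by rewrite mulr_gt0// ltr0n subn_gt0.
    have dle := gap_ge X i j (ltnW ij) (ltn_ord j); rewrite !siteE in dle.
    rewrite /g -opprD !powRN lef_pV2 ?posrE ?powR_gt0 ?(lt_le_trans d0)//.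
    apply: ge0_ler_powR (dle); rewrite ?nnegrE//; [lra|exact: ltW|].
    exact: le_trans (ltW d0) dle.
  apply: (le_trans (sum_cut_le _ _ _ _ _)) => [p|]; first exact: powR_ge0.
  rewrite mulr_sumr; apply: ler_sum => p _.
  rewrite /g powRM ?(ltW l0)// mulrA [leLHS]mulrC ler_wpM2l ?powR_ge0//.
  rewrite -{1}(@powRr1 _ p.+1%:R)// -powRD ?pnatr_eq0 ?implybT//.
  by rewrite addrCA subrr addr0.
have : l `^ (- n - 1) <= l `^ (- m - 1) * \sum_(p < K) p.+1%:R `^ (- m).
  by rewrite (le_trans low)// -balance.
rewrite -ler_pdivrMl ?powR_gt0// mulrC -powRB ?(gt_eqF l0) ?implybT//.
by rewrite (_ : - n - 1 - (- m - 1) = - (n - m)); last by ring.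
Qed.

(** * Partial sums of p^(-m) *)

Lemma powR_exp_ln {R : realType} (x s : R) : 0 < x -> x `^ s = expR (s * ln x).
Proof. by move=> x0; rewrite /powR gt_eqF. Qed.

(** With u = 1 / (p+1), the claim is (1 - u)^s <= 1 - s u / (1 + s).  It follows
from (1 - u)^s <= exp (- s u) <= 1 / (1 + s u) and u <= 1.  The constant s / (1 + s), smaller than the
best one, allows one proof for all s > 0, where the mean value theorem would
distinguish s < 1 from s > 1. *)
Lemma powRB_ge {R : realType} (s : R) (p : nat) : 0 < s ->
  s / (1 + s) * p.+1%:R `^ (s - 1) <= p.+1%:R `^ s - p%:R `^ s :> R.
Proof.
move=> s0; have P0 : 0 < p.+1%:R :> R by rewrite ltr0n.
have pE : p%:R = p.+1%:R * (1 - p.+1%:R^-1) :> R.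
  by rewrite mulrBr mulr1 divff ?gt_eqF// -[in RHS]natr1 addrK.
have u1 : 0 <= 1 - p.+1%:R^-1 :> R by rewrite subr_ge0 invf_le1// ler1n.
rewrite pE powRM// ?(ltW P0)// -{1}[p.+1%:R `^ s]mulr1 -mulrBr.
rewrite powRB ?(gt_eqF P0) ?implybT// powRr1 ?(ltW P0)//.
rewrite mulrCA ler_wpM2l ?powR_ge0//.
set u : R := p.+1%:R^-1 in u1 *.
have u0 : 0 < u by rewrite invr_gt0.
have h : (1 - u) `^ s <= (1 + s * u)^-1.
  have su : 0 < 1 + s * u by rewrite addr_gt0// mulr_gt0.
  move: u1; rewrite le_eqVlt => /predU1P[<-|u1].
    by rewrite powR0 ?gt_eqF// invr_ge0 ltW.
  rewrite powR_exp_ln// -[leLHS]invrK -expRN lef_pV2 ?posrE ?expR_gt0//.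
  apply: le_trans (expR_ge1Dx _); rewrite lerD2l -mulrN ler_pM2l//.
  have := @le_ln1Dx R (- u); rewrite ltrN2; lra.
apply: le_trans (lerB (lexx 1) h).
have u1' : u <= 1 by lra.
have su : 0 < 1 + s * u by rewrite addr_gt0// mulr_gt0.
have -> : 1 - (1 + s * u)^-1 = s * u / (1 + s * u) by field; rewrite gt_eqF.
rewrite mulrAC ler_pM2l ?mulr_gt0//.
rewrite lef_pV2 ?posrE ?addr_gt0 ?mulr_gt0// lerD2l.
by rewrite ger_pMr.
Qed.

(** Comparison with the telescoping sum of the increments of p^(1-m). *)
Lemma sum_powR_le_lt1 {R : realType} (m : R) (K : nat) : m < 1 ->
  \sum_(p < K) p.+1%:R `^ (- m) <= (2 - m) / (1 - m) * K%:R `^ (1 - m) :> R.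
Proof.
move=> m1; have s0 : 0 < 1 - m by rewrite subr_gt0.
have -> : K%:R `^ (1 - m) = \sum_(p < K) (p.+1%:R `^ (1 - m) - p%:R `^ (1 - m)) :> R.
  rewrite -(big_mkord xpredT (fun p => p.+1%:R `^ (1 - m) - p%:R `^ (1 - m))).
  by rewrite telescope_sumr// powR0 ?gt_eqF// subr0.
rewrite mulr_sumr; apply: ler_sum => p _.
have := powRB_ge _ p s0; rewrite addrAC subrr add0r.
have c0 : 0 < (1 - m) / (1 + (1 - m)) by rewrite divr_gt0// addr_gt0.
rewrite -(ler_pdivlMl _ _ c0).
by rewrite invf_div (_ : 1 + (1 - m) = 2 - m)//; ring.
Qed.

(** From the second term on, (p+2)^(-m) is at most 1/(m-1) times the decrement of
p^(1-m), so that the sum is at most 1 + 1/(m-1). *)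
Lemma sum_powR_le_gt1 {R : realType} (m : R) (K : nat) : 1 < m ->
  \sum_(p < K) p.+1%:R `^ (- m) <= m / (m - 1) :> R.
Proof.
move=> m1; have t0 : 0 < m - 1 by rewrite subr_gt0.
have step p : p.+2%:R `^ (- m) <=
    (m - 1)^-1 * (p.+1%:R `^ (1 - m) - p.+2%:R `^ (1 - m)) :> R.
  have P0 : 0 < p.+2%:R :> R by rewrite ltr0n.
  have Q0 : 0 < p.+1%:R :> R by rewrite ltr0n.
  rewrite ler_pdivlMl//.
  have -> : p.+1%:R `^ (1 - m) = p.+2%:R `^ (1 - m) * (p.+1%:R / p.+2%:R) `^ (1 - m) :> R.
    by rewrite -powRM ?divr_ge0 ?ltW// mulrCA divff ?gt_eqF// mulr1.
  rewrite -{2}[p.+2%:R `^ (1 - m)]mulr1 -mulrBr.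
  rewrite powRD ?(gt_eqF P0) ?implybT// powRr1 ?(ltW P0)// mulrC -mulrA mulrCA.
  rewrite ler_wpM2l ?powR_ge0//.
  set q : R := p.+1%:R / _; have q0 : 0 < q by rewrite divr_gt0.
  have qE : p.+2%:R * (1 - q) = 1 :> R.
    by rewrite mulrBr mulr1 mulrCA divff ?gt_eqF// mulr1 -natr1 addrAC subrr add0r.
  rewrite -ler_pdivrMl// powR_exp_ln//.
  have -> : p.+2%:R^-1 = 1 - q by rewrite -[LHS]mulr1 -[X in _ * X]qE mulKf ?gt_eqF.
  rewrite lerBrDl; apply: le_trans (expR_ge1Dx _); rewrite lerD2l.
  rewrite mulrC -[1 - m]opprB mulNr -mulrN ler_pM2l//.
  have := @le_ln1Dx R (q - 1); rewrite addrCA subrr addr0; lra.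
case: K => [|K]; first by rewrite big_ord0 divr_ge0 ?ltW// (lt_trans _ m1).
rewrite big_ord_recl/= powR1 (_ : m / (m - 1) = 1 + (m - 1)^-1 * 1); last first.
  by field; rewrite gt_eqF.
rewrite lerD2l; apply: (@le_trans _ _ (\sum_(p < K)
    (m - 1)^-1 * (p.+1%:R `^ (1 - m) - p.+2%:R `^ (1 - m)))).
  by apply: ler_sum => p _; exact: step.
rewrite -mulr_sumr ler_pM2l ?invr_gt0//.
rewrite -(big_mkord xpredT (fun p => p.+1%:R `^ (1 - m) - p.+2%:R `^ (1 - m))).
under eq_bigr do rewrite -opprB.
rewrite sumrN (telescope_sumr (fun p => p.+1%:R `^ (1 - m)))// powR1 opprB.
by rewrite gerBl powR_ge0.
Qed.

(** * The rates *)

Lemma powR_inv_le {R : realType} {l q M : R} : 0 < l -> 0 < q ->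
  l `^ (- q) <= M -> M `^ (- q^-1) <= l.
Proof.
move=> l0 q0 lM; have M0 : 0 < M by apply: lt_le_trans lM; exact: powR_gt0.
have -> : l = (l `^ (- q)) `^ (- q^-1).
  by rewrite -powRrM mulrNN divff ?gt_eqF// powRr1// ltW.
rewrite [M `^ _]powRN [leRHS]powRN lef_pV2 ?posrE ?powR_gt0//.
by rewrite ge0_ler_powR ?nnegrE ?powR_ge0 ?invr_ge0 ?(ltW q0) ?(ltW M0)//.
Qed.

Lemma terrace_rate_ge0 {R : realType} (m n alpha : R) N :
  0 <= terrace_rate m n alpha N.
Proof.
by rewrite /terrace_rate; do 2?case: ifP => // _; rewrite ?mulr_ge0 ?powR_ge0.
Qed.

Lemma size_rateE {R : realType} (m n alpha : R) N : (0 < N)%N ->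
  size_rate m n alpha N = N%:R * terrace_rate m n alpha N.
Proof.
move=> N0; have N0' : N%:R != 0 :> R by rewrite pnatr_eq0 -lt0n.
rewrite /size_rate /terrace_rate; do 2?case: ifP => // _; last by rewrite mulr1.
- by rewrite powRD ?N0' ?implybT// powRr1.
- by rewrite powRD ?N0' ?implybT// powRr1// mulrA.
Qed.

Lemma min_terrace_ge {R : realType} {m n alpha : R} {A b : R} {N}
    {X : 'rV[R]_N} :
  -1 < m -> m < n -> 0 <= alpha -> critical_point m n alpha X -> (2 <= N)%N ->
  0 < A ->
  \sum_(p < interaction_range alpha N) p.+1%:R `^ (- m) <= A * N%:R `^ b ->
  A `^ (- (n - m)^-1) * N%:R `^ (- (b / (n - m))) <= min_terrace X.
Proof.
move=> m1 mn a0 crit N2 A0 sumA; have [Xlt _] := crit.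
have q0 : 0 < n - m by rewrite subr_gt0.
have low := le_trans (min_terrace_powR_le m1 mn a0 crit N2) sumA.
apply: le_trans (powR_inv_le (min_terrace_gt0 X Xlt N2) q0 low).
by rewrite powRM ?powR_ge0 ?(ltW A0)// -powRrM mulrN.
Qed.

Lemma min_terrace_ge_lt1 {R : realType} {m n alpha : R} {N} {X : 'rV[R]_N} :
  -1 < m -> m < 1 -> m < n -> 0 <= alpha ->
  critical_point m n alpha X -> (2 <= N)%N ->
  ((2 - m) / (1 - m)) `^ (- (n - m)^-1) *
    N%:R `^ (- ((1 - m) * alpha / (n - m))) <= min_terrace X.
Proof.
move=> m_gtN1 m_lt1 mn a0 crit N2.
have A0 : 0 < (2 - m) / (1 - m) by apply: divr_gt0; lra.
apply: (min_terrace_ge m_gtN1 mn a0 crit N2 A0).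
apply: (le_trans (sum_powR_le_lt1 _ _ m_lt1)); rewrite ler_pM2l//.
rewrite [(1 - m) * alpha]mulrC powRrM
  ge0_ler_powR ?nnegrE ?powR_ge0 ?subr_ge0 ?(ltW m_lt1)//.
by rewrite truncn_le powR_ge0.
Qed.

Lemma min_terrace_ge_rate {R : realType} {m n alpha : R} :
  -1 < m -> m < n -> 0 <= alpha -> admissible_range m n alpha ->
  exists2 C : R, 0 < C & forall N (X : 'rV[R]_N), (2 <= N)%N ->
    critical_point m n alpha X -> C * terrace_rate m n alpha N <= min_terrace X.
Proof.
move=> m_gtN1 mn a0 adm.
have [sub|nsub] := boolP (sublinear_range m n alpha).
  have /and4P[/andP[_ m_lt1] _ _ _] := sub.
  exists (((2 - m) / (1 - m)) `^ (- (n - m)^-1)).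
    by apply: powR_gt0; apply: divr_gt0; lra.
  by move=> N X N2 crit; rewrite /terrace_rate sub; exact: min_terrace_ge_lt1.
have [lg|nlg] := boolP (logarithmic_range m n alpha).
  have /and3P[/eqP m0 n1 _] := lg.
  have n0 : 0 < n by lra.
  have m_lt1 : m < 1 by rewrite m0.
  have ln2 : 0 < ln 2 :> R by rewrite ln_gt0// ltr1n.
  exists (((2 - m) / (1 - m)) `^ (- (n - m)^-1) * ln 2 `^ n^-1).
    by rewrite mulr_gt0 ?powR_gt0//; apply: divr_gt0; lra.
  move=> N X N2 crit; rewrite /terrace_rate (negPf nsub) lg.
  apply: le_trans (min_terrace_ge_lt1 m_gtN1 m_lt1 mn a0 crit N2).
  (* The factor (ln 2)^(1/n) in C absorbs (ln N)^(-1/n) <= (ln 2)^(-1/n). *)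
  rewrite -!mulrA ler_wpM2l ?powR_ge0// mulrCA.
  rewrite m0 !subr0 mul1r ler_piMr ?powR_ge0//.
  rewrite powRN ler_pdivrMr ?mul1r.
    rewrite ge0_ler_powR ?nnegrE ?invr_ge0 ?(ltW n0) ?ln_ge0 ?ler1n ?(ltnW N2)//.
    by rewrite ler_ln ?posrE ?ltr0n ?ler_nat// ltnW.
  by rewrite powR_gt0// ln_gt0// ltr1n.
have [A A0 sumA] : exists2 A : R, 0 < A & forall N, (2 <= N)%N ->
    \sum_(p < interaction_range alpha N) p.+1%:R `^ (- m) <= A * N%:R `^ 0.
  move: adm; rewrite /admissible_range (negPf nsub) (negPf nlg)/=.
  case/orP => [/andP[/andP[m_gt1 _] _]|/andP[_ /eqP alpha0]].
    exists (m / (m - 1)); first by apply: divr_gt0; lra.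
    by move=> N N2; rewrite powRr0 mulr1; exact: sum_powR_le_gt1.
  exists 1 => // N _.
  by rewrite alpha0 /interaction_range powRr0 truncn1 big_ord1 powR1 mulr1.
exists (A `^ (- (n - m)^-1)); first exact: powR_gt0.
move=> N X N2 crit; rewrite /terrace_rate (negPf nsub) (negPf nlg).
by have := min_terrace_ge m_gtN1 mn a0 crit N2 A0 (sumA N N2);
  rewrite mul0r oppr0 powRr0.
Qed.

Lemma system_size_ge {R : realType} {N} (X : 'rV[R]_N) : (2 <= N)%N ->
  (N%:R - 1) * min_terrace X <= system_size X.
Proof.
case: N X => // N X N2; rewrite -natr1 addrK /system_size/=.
by have := gap_ge X 0 N (leq0n _) (ltnSn _); rewrite subn0.
Qed.

Lemma system_size_le {R : realType} {m n alpha : R} {N} {X : 'rV[R]_N} :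
  m < n -> 0 <= alpha -> critical_point m n alpha X -> (2 <= N)%N ->
  system_size X <= N%:R - 1.
Proof.
case: N X => // N X mn a0 crit N2; rewrite -natr1 addrK /system_size/=.
rewrite sum_terrace// -[leRHS](_ : \sum_(0 <= k < N) 1 = N%:R); last first.
  by rewrite sumr_const_nat subn0.
by apply: ler_sum_nat => k /andP[_ kN]; exact: terrace_le1 mn a0 crit _.
Qed.

Lemma critical_point_bounds {R : realType} {m n alpha : R} :
  -1 < m -> m < n -> 0 <= alpha -> admissible_range m n alpha ->
  exists C : R, 0 < C /\
    forall N : nat, (2 <= N)%N ->
    forall X : 'rV[R]_N, critical_point m n alpha X ->
      (lstar R >= min_terrace X /\
       min_terrace X >= C * terrace_rate m n alpha N) /\
      ((N%:R - 1) * lstar R >= system_size X /\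
       system_size X >= C * size_rate m n alpha N).
Proof.
move=> m1 mn a0 adm; have [C C0 rate] := min_terrace_ge_rate m1 mn a0 adm.
(* The factor 1/2 accounts for N - 1 >= N / 2 in the bound on the system size. *)
exists (C / 2); split; first exact: divr_gt0.
move=> N N2 X crit; have low := rate N X N2 crit; have [Xlt _] := crit.
have r0 : 0 <= C * terrace_rate m n alpha N.
  by rewrite mulr_ge0 ?(ltW C0)// terrace_rate_ge0.
split; split.
- exact: le_trans (min_terrace_le X 0 N2) (terrace_le1 mn a0 crit N2).
- by apply: le_trans low; lra.
- by rewrite mulr1; exact: system_size_le mn a0 crit N2.
- apply: le_trans (system_size_ge X N2).
  have N2' : 2 <= N%:R :> R by rewrite ler_nat.
  apply: (@le_trans _ _ ((N%:R - 1) * (C * terrace_rate m n alpha N))).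
    rewrite size_rateE ?(ltnW N2)//; nra.
  by rewrite ler_wpM2l//; lra.
Qed.

Lemma limn_einf_gt0 {R : realType} (u : nat -> \bar R) (c : R) (N0 : nat) :
  0 < c -> (forall N, (N0 <= N)%N -> (c%:E <= u N)%E) -> (0 < limn_einf u)%E.
Proof.
move=> c0 cu; apply: (@lt_le_trans _ _ c%:E); first by rewrite lte_fin.
rewrite limn_einf_lim; apply: lime_ge; first exact: is_cvg_einfs.
exists N0 => // N /= N0N; apply: le_ereal_inf_tmp.
by move=> _ [k /= Nk <-]; apply: cu; exact: leq_trans Nk.
Qed.

Theorem corollary2 (R : realType) (m n alpha : R)
    (hm : -1 < m) (hmn : m < n) (halpha : 0 <= alpha <= 1) :
  (admissible_range m n alpha ->
     exists C : R, 0 < C /\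
       forall N : nat, (2 <= N)%N ->
       forall X : 'rV[R]_N, critical_point m n alpha X ->
         (lstar R >= min_terrace X /\
          min_terrace X >= C * terrace_rate m n alpha N) /\
         ((N%:R - 1) * lstar R >= system_size X /\
          system_size X >= C * size_rate m n alpha N)) /\
  (((1 < m /\ m < n) /\ (0 < alpha /\ alpha <= 1)) \/
   ((-1 < m /\ m < n) /\ 1 < n /\ alpha = 0) ->
     forall X : forall N : nat, 'rV[R]_N,
       (forall N : nat, (1 <= N)%N -> critical_point m n alpha (X N)) ->
       non_bunching X).
Proof.
have a0 : 0 <= alpha by case/andP: halpha.
split=> [|range X crit]; first exact: critical_point_bounds.
have adm : admissible_range m n alpha.
  case: range => [[[m1 _] [al0 al1]]|[_ [_ al0]]].
    by rewrite /admissible_range /short_range m1 hmn al0 al1 !orbT.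
  by rewrite /admissible_range /nearest_neighbour_range hm hmn al0 eqxx !orbT.
have size1 N : size_rate m n alpha N = N%:R.
  rewrite /size_rate /sublinear_range /logarithmic_range.
  case: range => [[[m1 _] _]|[_ [_ ->]]]; last by rewrite ltxx !andbF.
  by rewrite (lt_gtF m1) andbF gt_eqF// (lt_trans _ m1).
have [C [C0 bounds]] := critical_point_bounds hm hmn a0 adm.
apply: (limn_einf_gt0 _ C 2) => // N N2.
have [_ [_]] := bounds N N2 (X N) (crit N (ltnW N2)).
by rewrite size1 lee_fin ler_pdivlMr ?ltr0n ?(ltnW N2).
Qed.
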